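(* Let $\gamma$ be a $3$-braid. Then $\gamma$ is conjugate in $B_3$ to one of the following $3$-braids: (A) $\Delta^{2\ell}a^p$ for $\ell\in\mathbb{Z}$, $p\geq 0$; (B) $\Delta^{2\ell}a^pb$ for $\ell\in\mathbb{Z}$, $p\in\{1,2,3\}$; (C) $\Delta^{2\ell}a^{p_1}b^{q_1}\cdots a^{p_r}b^{q_r}$ for $\ell\in\mathbb{Z}$, $r\geq 1$, $p_i,q_i\geq 2$, $i\in\{1,\dots,r\}$; (D) $\Delta^{2\ell+1}a^{p_1}b^{q_1}\cdots a^{p_{r-1}}b^{q_{r-1}}a^{p_r}$ for $\ell\in\mathbb{Z}$, $r\geq 1$, $p_r\geq 2$, $p_i,q_i\geq 2$, $i\in\{1,\dots,r-1\}$. If $\gamma$ is a positive $3$-braid, then $\ell\geq 0$. If the closure $\widehat{\gamma}$ is a knot, then only the cases (B)–(D) can occur, and $p$ must be odd in case (B), at least one of the $p_i$ and one of the $q_i$ must be odd in case (C), and at least one of the $p_i$ or $q_i$ must be odd in case (D).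
   Context: $B_3=\langle a,b\mid aba=bab\rangle$ is the braid group on three strands; its elements are called $3$-braids, and $\Delta=aba=bab$. A positive $3$-braid is an element of $B_3$ that can be written as a word in $a$ and $b$ only (no inverses). $\widehat{\gamma}$ denotes the closure of the geometric braid given by $\gamma$, where $a$ (resp. $b$) is the braid in which the first and second (resp. second and third) strands cross once positively. *)

(* Defs.v *)
From HB Require Import structures.
From mathcomp Require Import all_boot all_order all_fingroup all_algebra.
From mathcomp Require Import generic_quotient lra.
From mathcomp Require Import all_classical all_reals all_analysis.
Import Order.TTheory GRing.Theory Num.Theory numFieldNormedType.Exports.

Set Implicit Arguments.
Unset Strict Implicit.
Unset Printing Implicit Defensive.

(** * The braid group on three strands *)

(* The first component selects the generator ([false] for a, [true] for b),
   the second tells whether the letter is inverted. *)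
Definition letter : Type := (bool * bool)%type.
Definition word : Type := seq letter.

Inductive braid_eq : word -> word -> Prop :=
| braid_eq_refl w : braid_eq w w
| braid_eq_sym w1 w2 : braid_eq w1 w2 -> braid_eq w2 w1
| braid_eq_trans w2 w1 w3 : braid_eq w1 w2 -> braid_eq w2 w3 -> braid_eq w1 w3
| braid_eq_cancel u v k e :
    braid_eq (u ++ [:: (k, e); (k, ~~ e)] ++ v) (u ++ v)
| braid_eq_aba u v :
    braid_eq (u ++ [:: (false, false); (true, false); (false, false)] ++ v)
             (u ++ [:: (true, false); (false, false); (true, false)] ++ v).

Definition braid_eqb : rel word := fun u v => `[< braid_eq u v >].

Lemma braid_eqb_refl : reflexive braid_eqb.
Proof. by move=> w; apply/asboolP; exact: braid_eq_refl. Qed.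

Lemma braid_eqb_sym : symmetric braid_eqb.
Proof. by move=> u v; apply/asboolP/asboolP; exact: braid_eq_sym. Qed.

Lemma braid_eqb_trans : transitive braid_eqb.
Proof.
move=> v u w /asboolP uv /asboolP vw; apply/asboolP.
exact: braid_eq_trans uv vw.
Qed.

Canonical braid_equiv := EquivRel braid_eqb
  braid_eqb_refl braid_eqb_sym braid_eqb_trans.

Definition B3 : Type := {eq_quot braid_equiv}%qT.
HB.instance Definition _ := Choice.on B3.

Definition braid_of_word (w : word) : B3 := (\pi_{eq_quot braid_equiv} w)%qT.

Lemma braid_of_wordP u v : braid_of_word u = braid_of_word v <-> braid_eq u v.
Proof.
split=> [/eqmodP /asboolP //|uv]; apply/eqmodP; exact/asboolP.
Qed.

Lemma braid_of_word_surj (x : B3) : exists w, x = braid_of_word w.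
Proof. by exists (repr (x : {eq_quot braid_equiv})%qT); rewrite /braid_of_word reprK. Qed.

Definition word_inv (w : word) : word := rev [seq (l.1, ~~ l.2) | l <- w].

Lemma braid_eq_ctx s t u v : braid_eq u v -> braid_eq (s ++ u ++ t) (s ++ v ++ t).
Proof.
elim=> {u v} [w|w1 w2 _|w2 w1 w3 _ + _|u v k e|u v].
- exact: braid_eq_refl.
- exact: braid_eq_sym.
- exact: braid_eq_trans.
- by have := braid_eq_cancel (s ++ u) (v ++ t) k e; rewrite -!catA /=.
- by have := braid_eq_aba (s ++ u) (v ++ t); rewrite -!catA /=.
Qed.

Lemma braid_eq_cat u u' v v' :
  braid_eq u u' -> braid_eq v v' -> braid_eq (u ++ v) (u' ++ v').
Proof.
move=> uu' vv'; apply: (@braid_eq_trans (u' ++ v)).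
  exact: (@braid_eq_ctx [::]).
by have := @braid_eq_ctx u' [::] v v' vv'; rewrite !cats0.
Qed.

Lemma word_invK : involutive word_inv.
Proof.
move=> w; rewrite /word_inv map_rev revK -map_comp -[RHS]map_id.
by apply: eq_map => -[k e] /=; rewrite negbK.
Qed.

Lemma braid_eq_mulV w : braid_eq (w ++ word_inv w) [::].
Proof.
elim: w => [|[k e] w IHw]; first exact: braid_eq_refl.
rewrite /word_inv /= rev_cons -cats1 /=.
apply: (@braid_eq_trans [:: (k, e); (k, ~~ e)]).
  by have := @braid_eq_ctx [:: (k, e)] [:: (k, ~~ e)] _ _ IHw; rewrite /= -catA.
exact: (@braid_eq_cancel [::] [::]).
Qed.

Lemma braid_eq_mulVl w : braid_eq (word_inv w ++ w) [::].
Proof. by rewrite -{2}(word_invK w); exact: braid_eq_mulV. Qed.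

Lemma braid_eq_inv u v : braid_eq u v -> braid_eq (word_inv u) (word_inv v).
Proof.
move=> uv.
have step1 := braid_eq_ctx (word_inv u) [::] (braid_eq_sym (braid_eq_mulV v)).
apply: (@braid_eq_trans (word_inv u ++ (v ++ word_inv v))).
  by move: step1; rewrite !cats0.
rewrite catA; apply: (@braid_eq_cat _ [::] _ (word_inv v)); last exact: braid_eq_refl.
apply: (@braid_eq_trans (word_inv u ++ u)); last exact: braid_eq_mulVl.
by apply: braid_eq_cat (braid_eq_sym uv); exact: braid_eq_refl.
Qed.

Definition braid_one : B3 := braid_of_word [::].
Definition braid_mul (x y : B3) : B3 :=
  braid_of_word (repr (x : {eq_quot braid_equiv})%qT
                 ++ repr (y : {eq_quot braid_equiv})%qT).
Definition braid_inv (x : B3) : B3 :=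
  braid_of_word (word_inv (repr (x : {eq_quot braid_equiv})%qT)).

Lemma braid_repr w :
  braid_eq (repr (braid_of_word w : {eq_quot braid_equiv})%qT) w.
Proof. by apply/braid_of_wordP; rewrite {1}/braid_of_word reprK. Qed.

Lemma braid_mulE u v :
  braid_mul (braid_of_word u) (braid_of_word v) = braid_of_word (u ++ v).
Proof. by apply/braid_of_wordP; apply: braid_eq_cat; exact: braid_repr. Qed.

Lemma braid_invE u : braid_inv (braid_of_word u) = braid_of_word (word_inv u).
Proof. by apply/braid_of_wordP; apply: braid_eq_inv; exact: braid_repr. Qed.

Lemma braid_mulA : associative braid_mul.
Proof.
move=> x y z; have [u ->] := braid_of_word_surj x.
have [v ->] := braid_of_word_surj y; have [w ->] := braid_of_word_surj z.
by rewrite !braid_mulE catA.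
Qed.

Lemma braid_mul1 : left_id braid_one braid_mul.
Proof. by move=> x; have [u ->] := braid_of_word_surj x; rewrite braid_mulE. Qed.

Lemma braid_mulr1 : right_id braid_one braid_mul.
Proof.
by move=> x; have [u ->] := braid_of_word_surj x; rewrite braid_mulE cats0.
Qed.

Lemma braid_mulV : left_inverse braid_one braid_inv braid_mul.
Proof.
move=> x; have [u ->] := braid_of_word_surj x; rewrite braid_invE braid_mulE.
by apply/braid_of_wordP; exact: braid_eq_mulVl.
Qed.

Lemma braid_mulVr : right_inverse braid_one braid_inv braid_mul.
Proof.
move=> x; have [u ->] := braid_of_word_surj x; rewrite braid_invE braid_mulE.
by apply/braid_of_wordP; exact: braid_eq_mulV.
Qed.

HB.instance Definition _ := isGroup.Build B3
  braid_mulA braid_mul1 braid_mulr1 braid_mulV braid_mulVr.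

Definition gen (k : bool) : B3 := braid_of_word [:: (k, false)].
Definition a : B3 := gen false.
Definition b : B3 := gen true.
Definition Delta : B3 := (a * b * a)%g.

Lemma braid_relation : (a * b * a = b * a * b)%g.
Proof.
have mulE u v : (braid_of_word u * braid_of_word v)%g = braid_of_word (u ++ v).
  exact: braid_mulE.
rewrite /a /b /gen (mulE [:: _] [:: _]) (mulE [:: _; _] [:: _]).
rewrite (mulE [:: _] [:: _]) (mulE [:: _; _] [:: _]).
apply/braid_of_wordP; exact: (@braid_eq_aba [::] [::]).
Qed.

Definition expgz (G : groupType) (x : G) (l : int) : G :=
  match l with Posz n => x ^+ n | Negz n => x ^- n.+1 end%g.

Definition are_conjugate (G : groupType) (x y : G) : Prop :=
  exists g : G, y = (x ^ g)%g.

Definition positive_braid (x : B3) : Prop :=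
  exists s : seq bool, x = (\prod_(k <- s) gen k)%g.

(** * The list of normal forms *)

(* In [FormC l s] the list [s] consists of the pairs (p_i, q_i), 1 <= i <= r;
   in [FormD l s pr] it consists of the pairs (p_i, q_i), 1 <= i <= r - 1,
   and [pr] is p_r. *)
Inductive normal_form : Type :=
| FormA (l : int) (p : nat)
| FormB (l : int) (p : nat)
| FormC (l : int) (s : seq (nat * nat))
| FormD (l : int) (s : seq (nat * nat)) (pr : nat).

Definition admissible (F : normal_form) : bool :=
  match F with
  | FormA _ _ => true
  | FormB _ p => p \in [:: 1; 2; 3]
  | FormC _ s => (1 <= size s) && all (fun x => (2 <= x.1) && (2 <= x.2)) s
  | FormD _ s pr => all (fun x => (2 <= x.1) && (2 <= x.2)) s && (2 <= pr)
  end.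

Definition ell (F : normal_form) : int :=
  match F with FormA l _ | FormB l _ | FormC l _ | FormD l _ _ => l end.

Definition braid_of_form (F : normal_form) : B3 :=
  match F with
  | FormA l p => expgz Delta (2 * l)%R * a ^+ p
  | FormB l p => expgz Delta (2 * l)%R * a ^+ p * b
  | FormC l s =>
      expgz Delta (2 * l)%R * \prod_(x <- s) (a ^+ x.1 * b ^+ x.2)
  | FormD l s pr =>
      expgz Delta (2 * l + 1)%R * \prod_(x <- s) (a ^+ x.1 * b ^+ x.2)
        * a ^+ pr
  end%g.

Definition knot_condition (F : normal_form) : bool :=
  match F with
  | FormA _ _ => false
  | FormB _ p => odd p
  | FormC _ s => has (fun x => odd x.1) s && has (fun x => odd x.2) s
  | FormD _ s pr => has (fun x => odd x.1 || odd x.2) s || odd pr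
  end.

(** * Geometric braids, closures and knots *)

Section Geometry.
Local Open Scope classical_set_scope.
Local Open Scope ring_scope.
Variable R : realType.

(* The strands move in the plane, which is the fibre over the time parameter;
   at the beginning and at the end of the braid they occupy the three points
   (-1, 0), (0, 0), (1, 0). *)
Definition slot (j : 'I_3) : R * R := (j%:R - 1, 0).

Definition letter_perm (l : letter) : 'S_3 :=
  tperm (inord l.1) (inord l.1.+1).

(* Position at time t of the strand starting in slot j, for a single letter
   with generator k: the points in slots k and k + 1 exchange places by a half
   turn about their midpoint.  As (x, y, t) is right-handed, the half turn is
   counterclockwise for a positive crossing. *)
Definition crossing (l : letter) (j : 'I_3) (t : R) : R * R :=
  let k : nat := l.1 in
  let c := cos (pi * t) / 2 in
  let s := (-1) ^+ l.2 * sin (pi * t) / 2 in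
  if j == k :> nat then (k%:R - 2^-1 - c, - s)
  else if j == k.+1 :> nat then (k%:R - 2^-1 + c, s)
  else slot j.

(* Geometric braids are stacked as paths are: the first letter is run through
   during [0, 1/2], the rest of the word during [1/2, 1]. *)
Fixpoint strand (w : word) (j : 'I_3) (t : R) : R * R :=
  match w with
  | [::] => slot j
  | l :: w' => if t <= 2^-1 then crossing l j (2 * t)
               else strand w' (letter_perm l j) (2 * t - 1)
  end.

Definition word_perm (w : word) (j : 'I_3) : 'I_3 :=
  foldl (fun j l => letter_perm l j) j w.

Lemma crossing0 l j : crossing l j 0 = slot j.
Proof.
rewrite /crossing /slot mulr0 cos0 sin0 mulr0 mul0r oppr0.
case: eqP => [->|_]; first by congr (_, _); lra.
by case: eqP => [->|_] //; congr (_, _); rewrite mulrS; lra.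
Qed.

Lemma crossing1 l j : crossing l j 1 = slot (letter_perm l j).
Proof.
have lt_k : (l.1 < 3)%N by case: l.1.
have lt_k1 : (l.1.+1 < 3)%N by case: l.1.
rewrite /crossing /slot /letter_perm mulr1 cospi sinpi mulr0 mul0r oppr0.
case: tpermP => [->|->|]; rewrite ?inordK //.
- by rewrite eqxx; congr (_, _); rewrite mulrS; lra.
- by rewrite eqn_leq ltnn /= eqxx; congr (_, _); lra.
move=> /eqP jk /eqP jk1; case: eqP => [e|_].
  by case/eqP: jk; apply: val_inj; rewrite /= inordK.
case: eqP => [e|_] //.
by case/eqP: jk1; apply: val_inj; rewrite /= inordK.
Qed.

Lemma strand0 w j : strand w j 0 = slot j.
Proof. by case: w => //= l w; rewrite mulr0 invr_ge0 ler0n crossing0. Qed.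

Lemma strand1 w j : strand w j 1 = slot (word_perm w j).
Proof.
elim: w j => //= l w IHw j; rewrite leNgt invf_lt1 ?ltr0n // ltr1n /=.
by rewrite (_ : 2 * 1 - 1 = 1) ?IHw //; lra.
Qed.

(* The time direction is wrapped once around the z-axis.  The sign of the last
   coordinate makes (x, y, t) |-> wrap (x, y) t orientation preserving. *)
Definition wrap (p : R * R) (t : R) : R * R * R :=
  ((2 + p.1) * cos (2 * pi * t), (2 + p.1) * sin (2 * pi * t), - p.2).

Definition closure_of_word (w : word) : set (R * R * R) :=
  [set q | exists j t, 0 <= t <= 1 /\ q = wrap (strand w j t) t].

(* K is the image of an embedding of the circle R/Z in R^3. *)
Definition is_knot (K : set (R * R * R)) : Prop :=
  exists f : R -> R * R * R,
    [/\ continuous f,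
        forall t, f (t + 1) = f t,
        {in `[0, 1[ &, injective f} &
        K = range f].

(* The link type of [closure_of_word w] only depends on the braid represented
   by w, so any word for x may be used. *)
Definition closure_is_knot (x : B3) : Prop :=
  exists w, x = braid_of_word w /\ is_knot (closure_of_word w).

End Geometry.

(* Main.v *)
Require Import Defs.
From HB Require Import structures.
From mathcomp Require Import all_boot all_order all_fingroup all_algebra.
From mathcomp Require Import generic_quotient.
From mathcomp Require Import all_classical all_reals all_analysis.
From mathcomp Require Import zify lra.
Import Order.TTheory GRing.Theory Num.Theory numFieldNormedType.Exports.

Set Implicit Arguments.
Unset Strict Implicit.
Unset Printing Implicit Defensive.

(** Put tau for conjugation by Delta, which exchanges a and b; every 3-braid is
Delta ^ m * P with P a positive word, because a^-1 and b^-1 are positive words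
times Delta^-1.

Existence.  Conjugating Delta ^ m * P by the first letter of P moves that
letter to the end of P, twisted by tau ^ m: P is really a word on a circle,
twisted by tau ^ m.  If P has at least three letters and this circular word
contains aba or bab, a rotation brings it inside P, where it becomes a Delta:
the exponent m grows and P gets three letters shorter ([has_form_pos_word]).
What remains are the powers of a or b with m even, which give (A); the short
cases a * b with m even and a ^ 0, a ^ 1 with m odd, which give (B); and the
circular words all of whose maximal blocks have length at least 2
([reduced_blocks_ge2]).  Their number of blocks has the parity of m, whence
(C) and (D) ([has_form_reduced]).

Sign of l.  Let Y be one of the listed braids and g^-1 * gamma * g = Y with gamma
positive.  Then Y ^ n = Delta ^ c * (positive word) with c depending on g
only.  On the other hand no power of Delta can be extracted from the powers of
the positive part of Y, apart from the explicit one.  To see this, let B3 act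
on the right on its Garside normal forms, pairs (k, w) of an integer and a word
without aba and bab that stand for Delta ^ k * w
([garside_letter_action]): positive letters never decrease k, while Y
increases it by exactly 2 * l or 2 * l + 1.  So c <= n * (2 * l) or
c <= n * (2 * l + 1) for all n ([positive_translation_ge0]).  In (B) the
positive part may contain a hidden Delta, but there the exponent sum decides.

Knots.  The strands of a closed braid whose permutation fixes a slot j split
into the one that starts in j and all the others; these are two disjoint
nonempty compact sets, so the closure is disconnected and not the image of a
circle ([knot_no_fixed_slot]).  If the parity condition fails, the listed braid
acts on the slots as 1, as Delta, or as a power of a or of b, hence with a
fixed slot ([form_fixed_slot]), and having a fixed slot is invariant under
conjugation. *)

(** * Integer powers, conjugacy and the normal form Delta ^ m * P *)

Section IntegerPowers.
Variable G : groupType.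
Implicit Types (x : G) (m n : int).
Local Open Scope group_scope.

Lemma expgzS x m : expgz x (m + 1)%R = expgz x m * x.
Proof.
case: m => n; first by rewrite -PoszD addn1 /= expgSr.
have -> : (Negz n + 1)%R = (- n%:Z)%R by lia.
case: n => [|n] /=; first by rewrite expg1 mulVg.
by rewrite [x ^+ n.+2]expgS invgM mulgVK.
Qed.

Lemma expgz1 x : expgz x 1 = x. Proof. by rewrite /= expg1. Qed.

Lemma expgzD x m n : expgz x (m + n)%R = expgz x m * expgz x n.
Proof.
elim/int_ind: n => [|n IHn|n IHn]; first by rewrite addr0 mulg1.
  by rewrite -[n.+1]addn1 PoszD addrA !expgzS IHn mulgA.
apply: (mulIg x); rewrite -mulgA -!expgzS -addrA.
by have -> : (- n.+1%:Z + 1 = - n%:Z)%R by lia.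
Qed.

End IntegerPowers.

Section Conjugacy.
Variable G : groupType.
Implicit Types x y z : G.
Local Open Scope group_scope.

Lemma are_conjugate_refl x : are_conjugate x x.
Proof. by exists 1; rewrite conjg1. Qed.

Lemma are_conjugate_sym x y : are_conjugate x y -> are_conjugate y x.
Proof. by case=> g ->; exists g^-1; rewrite conjgK. Qed.

Lemma are_conjugate_trans y x z :
  are_conjugate x y -> are_conjugate y z -> are_conjugate x z.
Proof. by case=> g -> [h ->]; exists (g * h); rewrite conjgM. Qed.

Lemma are_conjugateC x y : are_conjugate (x * y) (y * x).
Proof. by exists x; rewrite conjgE -mulgA mulKg. Qed.

End Conjugacy.

Local Open Scope group_scope.

(** a * Delta = a * (b * a * b) = (a * b * a) * b = Delta * b. *)
Lemma gen_Delta c : gen c * Delta = Delta * gen (~~ c).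
Proof.
case: c => /=; rewrite -/a -/b; first by rewrite /Delta 2!mulgA -braid_relation.
by rewrite {1}/Delta braid_relation /Delta !mulgA.
Qed.

Lemma Delta_alt c : gen c * gen (~~ c) * gen c = Delta.
Proof. by case: c => //; rewrite -[LHS]braid_relation. Qed.

Lemma gen_expgz_Delta c m :
  gen c * expgz Delta m = expgz Delta m * gen (c (+) odd `|m|).
Proof.
elim/int_ind: m c => [|n IHn|n IHn] c; first by rewrite mulg1 mul1g addbF.
  rewrite -[n.+1]addn1 PoszD expgzS mulgA IHn -mulgA gen_Delta mulgA.
  by congr (_ * gen _); rewrite -PoszD /= addn1 /= addbN.
apply: (mulIg Delta).
have E : (- n.+1%:Z + 1 = - n%:Z)%R by lia.
rewrite -mulgA -expgzS E IHn -mulgA gen_Delta mulgA -expgzS E.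
by congr (_ * gen _); rewrite !abszN /= addbN negbK.
Qed.

Definition pos_word (w : seq bool) : B3 := \prod_(c <- w) gen c.

Lemma pos_word_cons c w : pos_word (c :: w) = gen c * pos_word w.
Proof. exact: big_cons. Qed.

Lemma pos_word_cat u v : pos_word (u ++ v) = pos_word u * pos_word v.
Proof. exact: big_cat. Qed.

Lemma pos_word1 c : pos_word [:: c] = gen c.
Proof. exact: big_seq1. Qed.

Lemma pos_word_nseq n c : pos_word (nseq n c) = gen c ^+ n.
Proof.
elim: n => [|n IHn]; first by rewrite /pos_word big_nil.
by rewrite /= pos_word_cons IHn expgS.
Qed.

Lemma pos_word_alt c : pos_word [:: c; ~~ c; c] = Delta.
Proof. by rewrite /pos_word !big_cons big_nil mulg1 mulgA Delta_alt. Qed.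

Lemma pos_word_expgz_Delta w m :
  pos_word w * expgz Delta m =
  expgz Delta m * pos_word [seq c (+) odd `|m| | c <- w].
Proof.
elim: w => [|c w IHw] /=; first by rewrite /pos_word !big_nil mul1g mulg1.
by rewrite !pos_word_cons -mulgA IHw !mulgA gen_expgz_Delta.
Qed.

Lemma pos_word_Delta w :
  pos_word w * Delta = Delta * pos_word [seq ~~ c | c <- w].
Proof.
rewrite -[Delta]expgz1 pos_word_expgz_Delta.
by congr (_ * pos_word _); apply: eq_map => c /=; rewrite addbT.
Qed.

(** A negative letter is absorbed by gen k * gen (~~ k) * gen k = Delta, which
gives (gen k)^-1 = gen (~~ k) * gen k * Delta^-1; the power of Delta is then
moved to the front. *)
Lemma Delta_pos_word_form x : exists m w, x = expgz Delta m * pos_word w.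
Proof.
have [u ->] := braid_of_word_surj x.
elim/last_ind: u => [|u [k e] [m [w IHu]]].
  by exists 0%R, [::]; rewrite /pos_word big_nil mulg1.
have -> : braid_of_word (rcons u (k, e)) =
          braid_of_word u * braid_of_word [:: (k, e)].
  by rewrite -cats1; exact: esym (braid_mulE _ _).
rewrite IHu; case: e; last first.
  by exists m, (rcons w k); rewrite -cats1 pos_word_cat pos_word1 mulgA.
have -> : braid_of_word [:: (k, true)] = (gen k)^-1.
  exact: esym (braid_invE [:: (k, false)]).
have -> : (gen k)^-1 = gen (~~ k) * gen k * expgz Delta (-1)%R.
  by rewrite /= expg1 -(Delta_alt k) -mulgA !invgM !mulgA mulgK mulgV mul1g.
exists (m - 1)%R, [seq c (+) true | c <- w ++ [:: ~~ k; k]].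
have -> : gen (~~ k) * gen k = pos_word [:: ~~ k; k].
  by rewrite pos_word_cons pos_word1.
rewrite -(mulgA (expgz _ m)) (mulgA (pos_word w)) -pos_word_cat.
by rewrite pos_word_expgz_Delta mulgA -expgzD.
Qed.

(** * Every braid is conjugate to a listed one *)

(** Of three consecutive letters over a two-letter alphabet, x y x with x != y
are excluded, that is aba and bab. *)
Fixpoint reduced (w : seq bool) : bool :=
  if w is x :: w' then
    (if w' is y :: z :: _ then (x == y) || (y == z) else true) && reduced w'
  else true.

Lemma reduced_catr u v : reduced (u ++ v) -> reduced v.
Proof. by elim: u => //= x u IHu /andP[_ /IHu]. Qed.

Lemma reducedPn w :
  reflect (exists u c v, w = u ++ [:: c; ~~ c; c] ++ v) (~~ reduced w).
Proof.
apply: (iffP idP) => [|[u [c [v ->]]]]; last first.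
  by apply: (contra (@reduced_catr u _)) => /=; case: c.
elim: w => [//|x w IHw]; rewrite [reduced _]/= negb_and => /orP[|/IHw]; last first.
  by case=> u [c [v ->]]; exists (x :: u), c, v.
case: w {IHw} => [//|y [//|z w]]; rewrite negb_or => /andP[xy yz].
by exists [::], x, w; case: x y z xy yz => -[] [].
Qed.

Definition twist (m : int) (c : bool) : bool := c (+) odd `|m|.

(** Rotation of the circular word: u is pulled through Delta ^ m to the front,
then conjugated to the end. *)
Lemma Delta_pos_word_rot m u v :
  are_conjugate (expgz Delta m * pos_word (u ++ v))
                (expgz Delta m * pos_word (v ++ map (twist m) u)).
Proof.
have -> : expgz Delta m * pos_word (u ++ v) =
          pos_word (map (twist m) u) * (expgz Delta m * pos_word v).
  rewrite mulgA pos_word_expgz_Delta -map_comp map_id_in ?pos_word_cat ?mulgA //.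
  by move=> c _ /=; rewrite /twist addbK.
rewrite (pos_word_cat v) (mulgA (expgz _ m)); exact: are_conjugateC.
Qed.

Lemma Delta_pos_word_negb m w :
  are_conjugate (expgz Delta m * pos_word w)
                (expgz Delta m * pos_word (map negb w)).
Proof.
exists Delta; rewrite conjgE -mulgA pos_word_Delta (mulgA _ Delta).
by rewrite -expgzS addrC expgzD expgz1 -mulgA mulKg.
Qed.

Lemma Delta_pos_word_shrink m u c v :
  expgz Delta m * pos_word (u ++ [:: c; ~~ c; c] ++ v) =
  expgz Delta (m + 1)%R * pos_word (map negb u ++ v).
Proof.
rewrite !pos_word_cat pos_word_alt (mulgA (pos_word u)) pos_word_Delta.
by rewrite expgzS !mulgA.
Qed.

(** The word whose successive maximal blocks have the lengths [ps], the first
block consisting of letters [c]. *)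
Fixpoint altword (c : bool) (ps : seq nat) : seq bool :=
  if ps is p :: ps' then nseq p c ++ altword (~~ c) ps' else [::].

Lemma last_altword c p ps x :
  all (leq 1) (p :: ps) -> last x (altword c (p :: ps)) = c (+) odd (size ps).
Proof.
elim: ps p c x => [|q ps IHps] [//|p] c x /= ps_gt0.
  by rewrite cats0 addbF; elim: p.
by rewrite last_cat IHps //= addbN addNb.
Qed.

(** What follows a block of length 1 is the other letter, be it the next block
or the letter appended at the end. *)
Lemma altword_next c w ps :
    c :: w = altword c (1%N :: ps) -> all (leq 2) ps ->
  exists v, rcons (c :: w) (~~ last c w) = [:: c, ~~ c & v].
Proof.
case: ps => [|[|p] ps] //= [->]; first by exists [::].
by move=> _ /=; eexists.
Qed.

(** A block of length 1 has the other letter on both sides, so it is the middle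
of aba or bab.  The letter appended to the word, different from the last one,
plays the part of the right neighbour for the last block; the first block has
no left neighbour here and escapes. *)
Lemma reduced_blocks c w :
    reduced (rcons (c :: w) (~~ last c w)) ->
  exists p ps, [/\ c :: w = altword c (p :: ps), (1 <= p)%N & all (leq 2) ps].
Proof.
elim: w c => [|d w IHw] c; first by exists 1%N, [::].
rewrite rcons_cons [last _ _]/= [reduced _]/= => /andP[red3 /IHw].
case=> -[|p] [ps [dwE // _ ps_ge2]].
have [cd|cd] := eqVneq c d.
  by exists p.+2, ps; split=> //; rewrite cd dwE.
have dE : d = ~~ c by case: c d cd {dwE IHw red3} => -[].
case: p => [|p] in dwE *; last first.
  by exists 1%N, (p.+2 :: ps); split=> //; rewrite dwE dE.
have [v vE] := altword_next dwE ps_ge2.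
by move: red3; rewrite -[rcons w _]/(behead (rcons (d :: w) (~~ last d w))) vE dE; case: (c).
Qed.

(** As [reduced_blocks], with a left neighbour for the first block too. *)
Lemma reduced_blocks_ge2 c w :
    reduced (~~ c :: rcons (c :: w) (~~ last c w)) ->
  exists p ps, c :: w = altword c (p :: ps) /\ all (leq 2) (p :: ps).
Proof.
move=> /= /andP[red3 /reduced_blocks[[|[|p]] [ps [cwE // _ ps_ge2]]]]; last first.
  by exists p.+2, ps.
have [v vE] := altword_next cwE ps_ge2.
by move: red3; rewrite -[rcons w _]/(behead (rcons (c :: w) (~~ last c w))) vE; case: (c).
Qed.

Lemma pos_word_altword ps :
    all (leq 2) ps ->
  exists s : seq (nat * nat),
    [/\ all (fun x => (2 <= x.1) && (2 <= x.2)) s, size s = (size ps)./2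
      & pos_word (altword false ps) = \prod_(x <- s) (a ^+ x.1 * b ^+ x.2) *
                                      (if odd (size ps) then a ^+ last 0 ps else 1)].
Proof.
have [n] := ubnP (size ps); elim: n ps => // n IHn [|p [|q ps]] /= size_ps.
- by exists [::]; split; rewrite // /pos_word !big_nil mulg1.
- exists [::]; split=> //.
  by rewrite cats0 pos_word_nseq big_nil mul1g.
case/and3P=> p2 q2 /IHn[|s [s_ge2 size_s sE]]; first exact: ltnW.
exists ((p, q) :: s); split; rewrite /= ?p2 ?q2 ?size_s //.
rewrite !pos_word_cat !pos_word_nseq sE big_cons negbK !mulgA.
by case: ps {sE size_s size_ps}.
Qed.

Definition has_form (x : B3) : Prop :=
  exists F, admissible F /\ are_conjugate x (braid_of_form F).

Lemma has_form_conj x y : are_conjugate x y -> has_form y -> has_form x.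
Proof. by move=> xy [F [? yF]]; exists F; split=> //; exact: are_conjugate_trans yF. Qed.

(** Division by 2 with remainder, in terms of the parity used in [twist]. *)
Lemma int_half m : exists l : int, m = (2 * l + odd `|m|)%R.
Proof.
case: m => n; first by exists n./2; rewrite /= -[in LHS](odd_double_half n); lia.
exists (- (uphalf n.+1)%:Z)%R; rewrite NegzE abszN.
by have := odd_double_half n.+1; have := uphalf_half n.+1; lia.
Qed.

Lemma FormB_pos_word l p :
  braid_of_form (FormB l p) =
  expgz Delta (2 * l)%R * pos_word (nseq p false ++ [:: true]).
Proof. by rewrite pos_word_cat pos_word_nseq pos_word1 mulgA. Qed.

(** For m = 2 * l + 1 and small n the braid is of type (B):
Delta is conjugate to a ^ 2 * b, and Delta * a to a ^ 3 * b. *)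
Lemma has_form_pow m n : has_form (expgz Delta m * a ^+ n).
Proof.
have [l ml] := int_half m; case: (odd _) ml => ml; last first.
  exists (FormA l n); split=> //=; rewrite ml addr0; exact: are_conjugate_refl.
have twist2l c : twist (2 * l)%R c = c by rewrite /twist abszM oddM addbF.
have shrink v : expgz Delta (2 * l)%R * pos_word ([:: false; true; false] ++ v) =
                expgz Delta m * pos_word v.
  by rewrite ml -(Delta_pos_word_shrink _ [::] false).
case: n => [|[|n]].
- exists (FormB l 2); split=> //; apply: are_conjugate_sym.
  rewrite FormB_pos_word -(pos_word_nseq 0 false) -(shrink [::]).
  have := Delta_pos_word_rot (2 * l)%R [:: false] [:: false; true].
  by rewrite (eq_map twist2l) map_id.
- exists (FormB l 3); split=> //; apply: are_conjugate_sym.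
  rewrite FormB_pos_word -(pos_word_nseq 1 false) -(shrink [:: false]).
  have := Delta_pos_word_rot (2 * l)%R [:: false; false] [:: false; true].
  by rewrite (eq_map twist2l) map_id.
exists (FormD l [::] n.+2); split=> //=; rewrite ml big_nil mulg1.
exact: are_conjugate_refl.
Qed.

(** The first letter is a, and the hypotheses say that on the circle it is
preceded by b and that the last letter is followed by a different one: the
letter after it is twist m false = odd `|m|.  Hence no block runs across the
ends of the word, and a parity count of blocks decides between (C) and (D). *)
Lemma has_form_reduced m w :
    last false w = ~~ odd `|m| ->
    reduced (true :: rcons (false :: w) (odd `|m|)) ->
  has_form (expgz Delta m * pos_word (false :: w)).
Proof.
move=> last_w red_w.
have [p [ps [wE ps_ge2]]] : exists p ps,
    false :: w = altword false (p :: ps) /\ all (leq 2) (p :: ps).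
  by apply: reduced_blocks_ge2; rewrite last_w negbK.
have ps_gt0 : all (leq 1) (p :: ps) by apply: sub_all ps_ge2 => i; exact: ltnW.
have odd_ps : odd (size ps) = ~~ odd `|m|.
  by have := last_altword false false ps_gt0; rewrite -wE /= last_w => ->.
have [s [s_ge2 size_s sE]] := pos_word_altword ps_ge2.
have [l ml] := int_half m; rewrite wE sE [odd _]/= odd_ps negbK.
case: (odd `|m|) odd_ps ml => odd_ps ml; last first.
  exists (FormC l s); rewrite [admissible _]/= s_ge2 andbT size_s; split.
    by case: (ps) odd_ps.
  rewrite mulg1 ml addr0; exact: are_conjugate_refl.
exists (FormD l s (last 0%N (p :: ps))); rewrite /= s_ge2; split.
  have /allP := ps_ge2; apply; exact: mem_last.
rewrite ml mulgA; exact: are_conjugate_refl.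
Qed.

Lemma constant_prefix c w :
  w = nseq (size w) c \/ exists i v, w = nseq i c ++ ~~ c :: v.
Proof.
elim: w => [|d w [IHw|[i [v IHw]]]]; first by left.
- have [->|dc] := eqVneq d c; first by left; rewrite /= -IHw.
  by right; exists 0%N, w; case: c d dc {IHw} => -[].
- right; have [->|dc] := eqVneq d c; first by exists i.+1, v; rewrite IHw.
  by exists 0%N, w; case: c d dc {IHw} => -[].
Qed.

(** Induction on the length of the word: rotate the circular word so that a
block starts at its beginning; either it is then in normal form, or it can be
rotated so that aba or bab occurs inside and shortened. *)
Lemma has_form_pos_word m w : has_form (expgz Delta m * pos_word w).
Proof.
have [n] := ubnP (size w); elim: n m w => // n IHn m w size_w.
have shrink x w' : size w' = size w ->
    are_conjugate x (expgz Delta m * pos_word w') -> ~~ reduced w' -> has_form x.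
  move=> size_w' xw' /reducedPn[u [c [v wE]]]; apply: (has_form_conj xw').
  rewrite wE Delta_pos_word_shrink; apply: IHn; move: size_w; rewrite -size_w' wE.
  by rewrite !size_cat size_map /=; lia.
case wE : w => [|c w1].
  by have := has_form_pow m 0; rewrite -(pos_word_nseq _ false).
have [w1E|[i [v w1E]]] := constant_prefix c w1.
  suff: has_form (expgz Delta m * pos_word (nseq (size w) false)).
    have -> : c :: w1 = nseq (size w) c by rewrite wE /= -w1E.
    case: (c) => //; apply: has_form_conj; rewrite -[false]/(negb true) -map_nseq.
    exact: Delta_pos_word_negb.
  rewrite pos_word_nseq; exact: has_form_pow.
(* Rotate to the first change of letters, so that a block starts there; then
   conjugate by Delta if needed, so that this block consists of letters a. *)
have [w2 [size_w2 last_w2 w2E]] : exists w2,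
    [/\ size (false :: w2) = size w, last false w2 = ~~ odd `|m|
      & are_conjugate (expgz Delta m * pos_word w)
                      (expgz Delta m * pos_word (false :: w2))].
  have := Delta_pos_word_rot m (nseq i.+1 c) (~~ c :: v).
  rewrite cat_cons -[nseq _ _ ++ _]/(c :: (nseq i c ++ ~~ c :: v)) -w1E -wE map_nseq => rot.
  have size_rot : size (v ++ nseq i.+1 (twist m c)) = size w1.
    by rewrite w1E !size_cat !size_nseq /=; lia.
  have last_rot x : last x (v ++ nseq i.+1 (twist m c)) = twist m c.
    by rewrite last_cat /=; elim: (i).
  case: c wE rot size_rot last_rot {w1E} => wE rot size_rot last_rot.
    exists (v ++ nseq i.+1 (twist m true)); split=> //.
      by rewrite wE -[RHS]/(size w1).+1 -size_rot.
  exists (map negb (v ++ nseq i.+1 (twist m false))); split.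
  - by rewrite -[LHS]/(size (map negb _)).+1 size_map size_rot wE.
  - by rewrite (last_map negb _ true) last_rot /twist.
  - apply: are_conjugate_trans rot _; exact: Delta_pos_word_negb.
have w2_gt0 : 0 < size w2.
  move: size_w2; rewrite wE w1E /= size_cat size_nseq /= => -[->].
  by rewrite addnS.
rewrite -wE.
have [red|] := boolP (reduced (true :: rcons (false :: w2) (odd `|m|))).
  apply: has_form_conj w2E _; exact: has_form_reduced.
have [w2_small|w2_big] := leqP (size w2) 1.
  case: w2 w2_small last_w2 {size_w2} w2E w2_gt0 => [//|x [|//]] _ /=.
  move=> -> w2E; have [l ml] := int_half m.
  case: (odd _) ml w2E => //= ml w2E _ _.
  exists (FormB l 1); split=> //; apply: are_conjugate_trans w2E _.
  rewrite FormB_pos_word ml addr0; exact: are_conjugate_refl.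
(* Locate aba or bab on the circle: across the beginning of the word, across
   its end, or inside. *)
move=> {w2_gt0} /reducedPn[[|x u] [d [t /=]]].
  case: w2 last_w2 w2E size_w2 w2_big => [//|y w2] last_w2 w2E size_w2 w2_big.
  case=> <- _ yE _; subst y; case/lastP: w2 => [//|w2 z] in last_w2 w2E size_w2 w2_big *.
  apply: (shrink _ (rcons w2 z ++ map (twist m) [:: false; true])).
  - by rewrite -size_w2 size_cat /= addn2.
  - apply: are_conjugate_trans w2E _; exact: (@Delta_pos_word_rot m [:: false; true]).
  - rewrite /= last_rcons in last_w2; apply/reducedPn.
    by exists w2, z, [::]; rewrite -cats1 -catA /twist /= last_w2 negbK.
case=> _; case/lastP: t => [|t z].
  rewrite -rcons_cons -[[:: d; ~~ d; d]]/(rcons [:: d; ~~ d] d) -rcons_cat => /rcons_inj[].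
  case: u => [|y u] /=; first by case: (w2) w2_big => [|? [|? []]].
  case=> _ w2_uc mc.
  apply: (shrink _ (w2 ++ map (twist m) [:: false])).
  - by rewrite -size_w2 size_cat /= addn1.
  - apply: are_conjugate_trans w2E _; exact: (@Delta_pos_word_rot m [:: false]).
  - apply/reducedPn; exists u, d, [::].
    by rewrite w2_uc -catA /twist /= mc.
rewrite -rcons_cons -!rcons_cons -!rcons_cat => /rcons_inj[w2_ucv _].
apply: (shrink _ (false :: w2)) => //.
by apply/reducedPn; exists u, d, t.
Qed.

(** * Actions of the braid group *)

Section BraidAction.
Variables (T : Type) (f : letter -> T -> T) (S : T -> Prop).

Definition act_word (w : word) (s : T) : T := foldl (fun s l => f l s) s w.

Definition braid_act (x : B3) (s : T) : T :=
  act_word (repr (x : {eq_quot braid_equiv})%qT) s.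

(** A right action of B3 given on letters.  It is only required to be an action
on the subset [S], which avoids a subtype for the reduced words below. *)
Record braid_action : Prop := BraidAction {
  action_stable : forall l s, S s -> S (f l s);
  action_cancel : forall k e s, S s -> f (k, ~~ e) (f (k, e) s) = s;
  action_relation : forall s, S s ->
    f (false, false) (f (true, false) (f (false, false) s)) =
    f (true, false) (f (false, false) (f (true, false) s)) }.

Hypothesis f_act : braid_action.

Lemma act_word_stable w s : S s -> S (act_word w s).
Proof. by elim: w s => //= l w IHw s Ss; apply: IHw; exact: action_stable. Qed.

Lemma act_word_braid_eq u v s : braid_eq u v -> S s -> act_word u s = act_word v s.
Proof.
move=> uv; elim: uv s => {u v} [w|w1 w2 _ IH|w2 w1 w3 _ IH1 _ IH2|u v k e|u v] s Ss //.
- by rewrite IH.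
- by rewrite IH1 ?IH2.
- rewrite /act_word !foldl_cat /= (action_cancel f_act) //; exact: act_word_stable.
- rewrite /act_word !foldl_cat /= (action_relation f_act) //; exact: act_word_stable.
Qed.

Lemma braid_act_word w s : S s -> braid_act (braid_of_word w) s = act_word w s.
Proof. by apply: act_word_braid_eq; exact: braid_repr. Qed.

Lemma braid_act_stable x s : S s -> S (braid_act x s).
Proof. exact: act_word_stable. Qed.

Lemma braid_act1 s : S s -> braid_act 1 s = s.
Proof. exact: (braid_act_word [::]). Qed.

Lemma braid_actM x y s : S s -> braid_act (x * y) s = braid_act y (braid_act x s).
Proof.
move=> Ss; have [u ->] := braid_of_word_surj x; have [v ->] := braid_of_word_surj y.
rewrite (braid_mulE u v : _ * _ = _) !braid_act_word //; last exact: act_word_stable.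
by rewrite /act_word foldl_cat.
Qed.

Lemma braid_act_gen k s : S s -> braid_act (gen k) s = f (k, false) s.
Proof. exact: braid_act_word. Qed.

Lemma braid_actK x s : S s -> braid_act x^-1 (braid_act x s) = s.
Proof. by move=> Ss; rewrite -braid_actM // mulgV braid_act1. Qed.

Lemma braid_actX x n s : S s -> braid_act (x ^+ n) s = iter n (braid_act x) s.
Proof.
move=> Ss; elim: n => [|n IHn]; first exact: braid_act1.
by rewrite expgSr braid_actM //= IHn.
Qed.

End BraidAction.

(** * The exponent sum *)

Definition exponent_shift (l : letter) (i : int) : int := (i + (-1) ^+ l.2)%R.

Lemma exponent_action : braid_action exponent_shift (fun=> True).
Proof. by split=> // k [] s _; rewrite /exponent_shift /=; lia. Qed.

Definition exponent (x : B3) : int := braid_act exponent_shift x 0%R.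

Lemma exponent_actE x i : braid_act exponent_shift x i = (i + exponent x)%R.
Proof.
rewrite /exponent /braid_act; move: (repr _) => w.
rewrite -{1}[i]addr0; elim: w (0%R) => //= l w IHw j.
by rewrite -IHw /exponent_shift addrA.
Qed.

Lemma exponentM x y : exponent (x * y) = (exponent x + exponent y)%R.
Proof. by rewrite {1}/exponent (braid_actM exponent_action) // exponent_actE. Qed.

Lemma exponent1 : exponent 1 = 0%R.
Proof. exact: braid_act1 exponent_action _ _. Qed.

Lemma exponent_gen c : exponent (gen c) = 1%R.
Proof. by rewrite /exponent (braid_act_gen exponent_action). Qed.

(** The exponent sum is a homomorphism to an abelian group. *)
Lemma exponentJ x g : exponent (x ^ g) = exponent x.
Proof.
by rewrite conjgE !exponentM addrCA -exponentM mulVg exponent1 addr0.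
Qed.

Lemma exponent_pos_word w : exponent (pos_word w) = Posz (size w).
Proof.
elim: w => [|c w IHw]; first by rewrite /pos_word big_nil exponent1.
by rewrite pos_word_cons exponentM IHw exponent_gen.
Qed.

Lemma exponent_Delta : exponent Delta = 3%R.
Proof. by rewrite -(pos_word_alt false) exponent_pos_word. Qed.

Lemma exponent_expgz x m : exponent (expgz x m) = (m * exponent x)%R.
Proof.
elim/int_ind: m => [|n IHn|n IHn]; first by rewrite exponent1 mul0r.
  by rewrite -[n.+1]addn1 PoszD expgzS exponentM IHn; lia.
have : (- n%:Z = - n.+1%:Z + 1)%R by lia.
by move=> E; move: IHn; rewrite {1}E expgzS exponentM; lia.
Qed.

Lemma exponentX x n : exponent (x ^+ n) = (n%:Z * exponent x)%R.
Proof. exact: (exponent_expgz x n). Qed.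

(** * Garside normal forms *)

(** Right multiplication of Delta ^ s.1 * rev s.2 by a generator: words are
stored with their last letter first.  When the new letter completes aba or
bab, that Delta is moved to the front and twists the rest of the word. *)
Definition garside_push (c : bool) (s : int * seq bool) : int * seq bool :=
  if s.2 is x :: y :: w then
    if (x != c) && (y == c) then ((s.1 + 1)%R, map negb w) else (s.1, c :: s.2)
  else (s.1, c :: s.2).

(** Right multiplication by the inverse of a generator c: a final letter c is
removed; otherwise c^-1 = Delta^-1 * c * (~~ c), and Delta^-1 is moved to the
front and twists the word. *)
Definition garside_pull (c : bool) (s : int * seq bool) : int * seq bool :=
  if s.2 is x :: w then
    if x == c then (s.1, w) else ((s.1 - 1)%R, [:: ~~ c, c & map negb s.2])
  else ((s.1 - 1)%R, [:: ~~ c; c]).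

Definition garside_letter (l : letter) : int * seq bool -> int * seq bool :=
  (if l.2 then garside_pull else garside_push) l.1.

Definition garside_form (s : int * seq bool) : Prop := reduced s.2.

Lemma reduced_negb w : reduced (map negb w) = reduced w.
Proof.
elim: w => //= x w ->; congr (_ && _).
by case: w => [|y [|z w]] //; case: x y z => -[] [].
Qed.

Lemma negb_mapK : involutive (map negb).
Proof. exact: mapK negbK. Qed.

(** Multiplication by aba and by bab both amount to the multiplication by Delta,
which is the braid relation for the action. *)
Lemma garside_push_alt c k w :
    reduced w ->
  garside_push c (garside_push (~~ c) (garside_push c (k, w))) =
  ((k + 1)%R, map negb w).
Proof.
case: w => [|x [|y [|z w]]]; rewrite /garside_push /=.
- by case: c.
- by case: c x => -[].
- by case: c x y => -[] [].
- by case: c x y z => -[] [] [] //=; case: w => [|[] w].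
Qed.

Lemma garside_letter_action : braid_action garside_letter garside_form.
Proof.
split.
- case=> c [] [k w]; rewrite /garside_form /garside_letter /=.
    case: w => [|x w] //; rewrite /garside_pull [X in _ -> reduced X]/=.
    case: eqP => [_ /(@reduced_catr [:: x])//|/eqP xc].
    have -> : x = ~~ c by case: c x xc => -[].
    by rewrite -reduced_negb /= negbK; case: w => [|y w] /=; rewrite !eqxx ?orbT.
  case: w => [|x [|y w]] //; rewrite /garside_push [(k, _).2]/=.
  case: ifP => [_ /(@reduced_catr [:: x; y])|cxy xyw]; first by rewrite reduced_negb.
  by case: c x y cxy xyw => -[] [] //= _ ->.
- move=> c e [k w]; rewrite /garside_form /garside_letter /=; case: e => /=.
    case: w => [|x w] /=.
      by rewrite /garside_push /garside_pull /= eqxx; case: c => /= _; rewrite subrK.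
    rewrite /garside_pull /=; case: eqP => [->|] /=.
      by case: w => [|y [|z w]] //=; case: c y z => -[] [].
    by rewrite /garside_push /= eqxx; case: c x => -[] //= _; rewrite subrK negb_mapK.
  case: w => [|x [|y w]] /=; rewrite /garside_push /garside_pull /= ?eqxx //.
  case: c x y => -[] [] //=; case: w => [|[] w] //= _; rewrite addrK ?negb_mapK //.
- case=> k w; rewrite /garside_form /garside_letter /= => red_w.
  by rewrite (garside_push_alt false) ?(garside_push_alt true).
Qed.

Notation garside_act := (braid_act garside_letter).

Lemma garside_act_gen c s :
  garside_form s -> garside_act (gen c) s = garside_push c s.
Proof. exact: braid_act_gen garside_letter_action _ _. Qed.

Lemma garside_act_Delta k w :
  reduced w -> garside_act Delta (k, w) = ((k + 1)%R, map negb w).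
Proof.
move=> red_w; have ga := garside_letter_action.
have red_aw := action_stable ga (false, false) (s := (k, w)) red_w.
rewrite /Delta !(braid_actM ga) // !garside_act_gen //.
  exact: garside_push_alt.
exact: (action_stable ga (true, false) red_aw).
Qed.

Lemma map_twistS m w : map negb (map (twist m) w) = map (twist (m + 1)%R) w.
Proof. by rewrite -map_comp; apply: eq_map => x; rewrite /twist /=; case: x; lia. Qed.

Lemma reduced_twist m w : reduced (map (twist m) w) = reduced w.
Proof.
rewrite /twist; case: (odd _); last by rewrite map_id_in // => x _; exact: addbF.
by rewrite -reduced_negb -map_comp map_id_in // => x _; rewrite /= addbT negbK.
Qed.

Lemma garside_act_expgz_Delta m k w :
  reduced w -> garside_act (expgz Delta m) (k, w) = ((k + m)%R, map (twist m) w).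
Proof.
move=> red_w; have ga := garside_letter_action.
elim/int_ind: m => [|n IHn|n IHn].
- by rewrite (braid_act1 ga) // addr0 map_id_in // => x _; rewrite /twist addbF.
- rewrite -[n.+1]addn1 PoszD expgzS (braid_actM ga) // IHn.
  by rewrite garside_act_Delta ?reduced_twist // map_twistS addrA.
set s := ((k - n.+1%:Z)%R, map (twist (- n.+1%:Z)%R) w).
have red_s : garside_form s by rewrite /garside_form reduced_twist.
have E : (- n%:Z = - n.+1%:Z + 1)%R by lia.
have sE : garside_act Delta s = garside_act (expgz Delta (- n%:Z)%R) (k, w).
  rewrite garside_act_Delta // IHn map_twistS /=.
  by congr (_, map (twist _) _); lia.
rewrite -[RHS](braid_actK ga Delta red_s) sE E expgzS (braid_actM ga) // (braid_actK ga) //.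
exact: (braid_act_stable ga).
Qed.

(** Positive letters never decrease the power of Delta. *)
Lemma garside_act_pos_word_ge w s :
  garside_form s -> (s.1 <= (garside_act (pos_word w) s).1)%R.
Proof.
have ga := garside_letter_action.
elim: w s => [|c w IHw] s red_s; first by rewrite /pos_word big_nil (braid_act1 ga).
rewrite pos_word_cons (braid_actM ga) //; apply: le_trans (IHw _ _).
  rewrite garside_act_gen // /garside_push; case: s.2 => [|x [|y v]] //=.
  by case: ifP => //= _; rewrite lerDl.
exact: (braid_act_stable ga).
Qed.

Lemma pos_word_expg w n : exists v, pos_word w ^+ n = pos_word v.
Proof.
elim: n => [|n [v vE]]; first by exists [::]; rewrite /pos_word big_nil.
by exists (w ++ v); rewrite pos_word_cat expgS vE.
Qed.

(** Growth argument: [Q] describes an invariant set of normal forms on which y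
increases the power of Delta by exactly m, so y ^ n has power m * n when it
acts on the trivial form.  But y ^ n is g^-1 * x ^ n * g with x ^ n positive, so
this power is at least a constant that depends on g only. *)
Lemma positive_translation_ge0 (Q : int * seq bool -> Prop) m x y :
    positive_braid x -> are_conjugate x y -> Q (0%R, [::]) ->
    (forall s, Q s ->
       [/\ garside_form s, Q (garside_act y s) & (garside_act y s).1 = (s.1 + m)%R]) ->
  (0 <= m)%R.
Proof.
case=> w xE [g yE] Q0 Qstep; have ga := garside_letter_action.
have [i [u uE]] := Delta_pos_word_form g^-1.
have [j [v vE]] := Delta_pos_word_form g.
have power_form n : exists t, y ^+ n = expgz Delta (i + j)%R * pos_word t.
  have [wn wnE] := pos_word_expg w n.
  exists (map (twist j) (u ++ wn) ++ v).
  rewrite yE -conjXg conjgE xE -/(pos_word w) wnE uE vE.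
  rewrite (mulgA (pos_word wn)) -(mulgA (expgz _ i)) (mulgA (pos_word u)).
  rewrite (mulgA (pos_word u)) -pos_word_cat pos_word_expgz_Delta.
  by rewrite -(mulgA (expgz _ j)) -pos_word_cat mulgA -expgzD.
have power_act n : Q (garside_act (y ^+ n) (0%R, [::])) /\
    (garside_act (y ^+ n) (0%R, [::])).1 = (m * n%:Z)%R.
  rewrite (braid_actX ga) //; elim: n => [|n [Qn IHn]]; first by rewrite mulr0.
  by have [_ ? E] := Qstep _ Qn; split=> //=; rewrite E IHn; lia.
have bound n : (i + j <= m * n%:Z)%R.
  have [t tE] := power_form n; rewrite -(power_act n).2 tE (braid_actM ga) //.
  rewrite garside_act_expgz_Delta //= add0r.
  exact: (@garside_act_pos_word_ge t ((i + j)%R, [::])).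
by have := bound `|(i + j)%R|.+1; nia.
Qed.

(** * Positive braids have nonnegative l *)

(** Blocks of length at least 2 of letters [c] can be appended without creating
aba or bab: the word is empty, or ends in a block of the other letter of
length at least 2. *)
Definition ready (c : bool) (s : int * seq bool) : Prop :=
  garside_form s /\ (s.2 = [::] \/ exists w, s.2 = [:: ~~ c, ~~ c & w]).

Lemma garside_push_same c k w :
  garside_push c (k, c :: w) = (k, [:: c, c & w]).
Proof. by rewrite /garside_push /=; case: w => [|y w] //; rewrite eqxx. Qed.

Lemma garside_push_ready c s : ready c s -> garside_push c s = (s.1, c :: s.2).
Proof.
case: s => k w [_ /= [->|[v ->]]] //; rewrite /garside_push /=.
by case: c.
Qed.

Lemma garside_act_expg_ready c p s :
    2 <= p -> ready c s ->
  (garside_act (gen c ^+ p) s).1 = s.1 /\ ready (~~ c) (garside_act (gen c ^+ p) s).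
Proof.
case: p => [|[|p]] // _ rs; have [red_s _] := rs; have ga := garside_letter_action.
suff E : garside_act (gen c ^+ p.+2) s = (s.1, [:: c, c & nseq p c ++ s.2]).
  have := braid_act_stable ga (gen c ^+ p.+2) red_s; rewrite {}E => red.
  by split=> //; split=> //; right; exists (nseq p c ++ s.2); rewrite negbK.
elim: p => [|p IHp].
  rewrite expgS expg1 (braid_actM ga) // garside_act_gen; last exact: (braid_act_stable ga).
  by rewrite garside_act_gen // (garside_push_ready rs) garside_push_same.
rewrite expgSr (braid_actM ga) // garside_act_gen; last exact: (braid_act_stable ga).
by rewrite IHp garside_push_same.
Qed.

Lemma garside_act_blocks_ready (s : seq (nat * nat)) t :
    all (fun x => (2 <= x.1) && (2 <= x.2)) s -> ready false t ->
  let x := \prod_(x <- s) (a ^+ x.1 * b ^+ x.2) in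
  (garside_act x t).1 = t.1 /\ ready false (garside_act x t).
Proof.
have ga := garside_letter_action.
elim: s t => [|[p q] s IHs] t /=; first by move=> _ [red_t ?]; rewrite big_nil (braid_act1 ga).
case/andP=> /andP[p2 q2] s2 rt; have [red_t _] := rt.
have [Ep rp] := garside_act_expg_ready p2 rt; have [red_p _] := rp.
have [Eq rq] := garside_act_expg_ready q2 rp; have [red_q _] := rq.
have [Es rs] := IHs _ s2 rq.
by rewrite big_cons !(braid_actM ga) //= Es Eq Ep.
Qed.

Lemma ready_twist c k m w :
  ready c (k, w) -> ready (twist m c) ((k + m)%R, map (twist m) w).
Proof.
case=> red_w /= w_end; split; first by rewrite /garside_form /= reduced_twist.
case: w_end => [->|[v ->]]; [by left|right].
by exists (map (twist m) v); rewrite /= /twist addNb.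
Qed.

Lemma ell_ge0_of_positive x F :
    positive_braid x -> admissible F -> are_conjugate x (braid_of_form F) ->
  (0 <= ell F)%R.
Proof.
have ga := garside_letter_action.
move=> x_pos; case: F => [l p|l p|l s|l s p] /= adm xF.
- suff : (0 <= 2 * l)%R by lia.
  apply: (@positive_translation_ge0 (fun s => exists n, s.2 = nseq n false) _ _ _ x_pos xF).
    by exists 0%N.
  case=> k _ [n /= ->].
  have red_n i : reduced (nseq i false) by elim: i => [|[|[|i]]].
  have red_kn j : garside_form (j, nseq n false) := red_n n.
  have twist_n : map (twist (2 * l)) (nseq n false) = nseq n false.
    by rewrite map_nseq /twist abszM oddM.
  rewrite (braid_actM ga) // garside_act_expgz_Delta // twist_n (braid_actX ga) //.
  suff E : iter p (garside_act a) ((k + 2 * l)%R, nseq n false) =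
           ((k + 2 * l)%R, nseq (p + n) false).
    by rewrite E; split=> //; exists (p + n)%N.
  elim: p {xF} => // p /= ->; rewrite garside_act_gen; last exact: red_n.
  by case: (p + n)%N => // q; rewrite garside_push_same.
(* The exponent sum 6 * l + p + 1 is nonnegative and p <= 3. *)
- case: x_pos xF => w -> [g /(congr1 exponent)].
  rewrite exponentJ -/(pos_word w) exponent_pos_word !exponentM exponent_expgz exponent_Delta.
  by rewrite exponent_gen exponentX exponent_gen; move: adm; rewrite !inE; lia.
- suff : (0 <= 2 * l)%R by lia.
  apply: (@positive_translation_ge0 (ready false) _ _ _ x_pos xF).
    by split=> //; left.
  case/andP: adm => _ s2 [k w] rw; have [red_w _] := rw.
  rewrite (braid_actM ga) // garside_act_expgz_Delta //.
  have rT : ready false ((k + 2 * l)%R, map (twist (2 * l)) w).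
    by have := ready_twist (2 * l)%R rw; rewrite {1}/twist abszM oddM.
  by have [E rs] := garside_act_blocks_ready s2 rT; split.
- suff : (0 <= 2 * l + 1)%R by lia.
  apply: (@positive_translation_ge0 (ready true) _ _ _ x_pos xF).
    by split=> //; left.
  case/andP: adm => s2 p2 [k w] rw; have [red_w _] := rw.
  have red_wT : reduced (map (twist (2 * l + 1)) w) by rewrite reduced_twist.
  rewrite !(braid_actM ga) ?garside_act_expgz_Delta //.
    (* The odd power of Delta turns the last block, of letters a, into one of
       letters b, after which the word of Y, starting with a, can be appended. *)
    have rT : ready false ((k + (2 * l + 1))%R, map (twist (2 * l + 1)) w).
      have -> : false = twist (2 * l + 1)%R true by rewrite /twist; lia.
      exact: ready_twist.
    have [Es rs] := garside_act_blocks_ready s2 rT.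
    have [Ep rp] := garside_act_expg_ready p2 rs.
    by have [red_p _] := rp; split=> //; rewrite Ep Es.
Qed.

(** * The permutation of a braid *)

Definition letter_move (l : letter) (j : 'I_3) : 'I_3 := letter_perm l j.

(** The values as natural numbers, which makes the relations between these
transpositions decidable by computation. *)
Lemma letter_moveE l j :
  letter_move l j =
  (if j == l.1 :> nat then l.1.+1 else if j == l.1.+1 :> nat then l.1 : nat else j) :> nat.
Proof.
have [lt_k lt_k1] : l.1 < 3 /\ l.1.+1 < 3 by case: l.1.
rewrite /letter_move /letter_perm permE /= -!val_eqE /= !inordK //.
by case: eqP => _; [rewrite inordK | case: eqP => _; rewrite ?inordK].
Qed.

Lemma letter_perm_action : braid_action letter_move (fun=> True).
Proof.
split=> // [k e|] j _; first exact: tpermK.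
by apply: val_inj; rewrite /= !letter_moveE; case: j => -[|[|[|]]].
Qed.

Notation perm_act := (braid_act letter_move).

Lemma perm_act_even x m j :
    (forall i, perm_act x (perm_act x i) = i) -> ~~ odd `|m| ->
  perm_act (expgz x m) j = j.
Proof.
have pa := letter_perm_action.
move=> x_inv.
have iter_even n i : ~~ odd n -> perm_act (x ^+ n) i = i.
  rewrite (braid_actX pa) // => /even_halfK <-; elim: (n./2) => //= h IHh.
  by rewrite x_inv IHh.
case: m => n /= n_even; first exact: iter_even.
by rewrite -{1}(iter_even n.+1 j n_even) (braid_actK pa).
Qed.

Lemma perm_act_genE c j : perm_act (gen c) j = letter_move (c, false) j.
Proof. exact: (braid_act_gen letter_perm_action). Qed.

Lemma perm_act_genK c j : perm_act (gen c) (perm_act (gen c) j) = j.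
Proof. rewrite !perm_act_genE; exact: tpermK. Qed.

Lemma perm_act_expg_even c n j : ~~ odd n -> perm_act (gen c ^+ n) j = j.
Proof. by move=> n_even; apply: (@perm_act_even _ n) => // i; exact: perm_act_genK. Qed.

Lemma perm_act_expg_fixed x n j : perm_act x j = j -> perm_act (x ^+ n) j = j.
Proof.
by move=> xj; rewrite (braid_actX letter_perm_action) //; elim: n => //= n ->.
Qed.

Lemma perm_act_a2 : perm_act a (inord 2) = inord 2.
Proof. by rewrite perm_act_genE; apply: val_inj; rewrite /= letter_moveE inordK. Qed.

Lemma perm_act_b0 : perm_act b (inord 0) = inord 0.
Proof. by rewrite perm_act_genE; apply: val_inj; rewrite /= letter_moveE inordK. Qed.

Lemma perm_act_Delta j : perm_act Delta j = 2 - j :> nat.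
Proof.
rewrite /Delta !(braid_actM letter_perm_action) // !perm_act_genE !letter_moveE.
by case: j => -[|[|[|]]].
Qed.

Lemma perm_act_DeltaK j : perm_act Delta (perm_act Delta j) = j.
Proof.
apply: val_inj; rewrite /= !perm_act_Delta; have := ltn_ord j; lia.
Qed.

Lemma perm_act_prod_fixed (I : Type) (s : seq I) (F : I -> B3) (P : pred I) j :
    all P s -> (forall i, P i -> perm_act (F i) j = j) ->
  perm_act (\prod_(i <- s) F i) j = j.
Proof.
have pa := letter_perm_action.
move=> /[swap] FP; elim: s => [|i s IHs] /=; first by rewrite big_nil (braid_act1 pa).
by case/andP=> /FP Fi /IHs sj; rewrite big_cons (braid_actM pa) // Fi sj.
Qed.

(** a fixes slot 2, b fixes slot 0, Delta fixes slot 1, and even powers of a, b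
and Delta fix everything. *)
Lemma form_fixed_slot F :
  admissible F -> ~~ knot_condition F -> exists j, perm_act (braid_of_form F) j = j.
Proof.
have pa := letter_perm_action.
have even2 l j : perm_act (expgz Delta (2 * l)%R) j = j.
  by apply: perm_act_even => [i|]; [exact: perm_act_DeltaK|rewrite abszM oddM].
case: F => [l p|l p|l s|l s p] /= adm knotF.
- exists (inord 2); rewrite (braid_actM pa) // even2.
  exact: perm_act_expg_fixed perm_act_a2.
- exists (inord 0); rewrite !(braid_actM pa) // even2 perm_act_expg_even //.
  exact: perm_act_b0.
- move: knotF; rewrite negb_and -!all_predC => /orP[] s_even.
    exists (inord 0); rewrite (braid_actM pa) // even2.
    apply: perm_act_prod_fixed s_even _ => -[p q] /= p_even.
    rewrite (braid_actM pa) // (perm_act_expg_even false _ p_even).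
    by rewrite (perm_act_expg_fixed _ perm_act_b0).
  exists (inord 2); rewrite (braid_actM pa) // even2.
  apply: perm_act_prod_fixed s_even _ => -[p q] /= q_even.
  by rewrite (braid_actM pa) // (perm_act_expg_fixed _ perm_act_a2) perm_act_expg_even.
- move: knotF; rewrite negb_or -all_predC => /andP[s_even p_even].
  exists (inord 1); rewrite !(braid_actM pa) // expgzS (braid_actM pa) // even2.
  have -> : perm_act Delta (inord 1) = inord 1.
    by apply: val_inj; rewrite /= perm_act_Delta inordK.
  rewrite (perm_act_prod_fixed s_even) ?perm_act_expg_even // => -[q r] /=.
  rewrite negb_or => /andP[q_even r_even].
  by rewrite (braid_actM pa) // !perm_act_expg_even.
Qed.

(** * Closures of braids with a fixed slot are disconnected *)

Section ClosedBraids.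
Variable R : realType.
Local Open Scope classical_set_scope.
Local Open Scope ring_scope.
Implicit Types (w : word) (j : 'I_3) (t : R).

Lemma continuous_pair (T U V : topologicalType) (f : T -> U) (g : T -> V) :
  continuous f -> continuous g -> continuous (fun x => (f x, g x)).
Proof. by move=> f_cont g_cont x; exact: (cvg_pair (f_cont x) (g_cont x)). Qed.

Lemma crossing_continuous l j : continuous (crossing l j : R -> R * R).
Proof.
have cos_cont : continuous (fun t : R => cos (pi * t) / 2).
  move=> t; apply: cvgMl; apply: continuous_comp; last exact: continuous_cos.
  by apply: cvgMr; exact: cvg_id.
have sin_cont : continuous (fun t : R => (-1) ^+ l.2 * sin (pi * t) / 2).
  move=> t; apply: cvgMl; apply: cvgMr; apply: continuous_comp; last exact: continuous_sin.
  by apply: cvgMr; exact: cvg_id.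
rewrite /crossing; case: eqP => _; last case: eqP => _; last by move=> t; exact: cvg_cst.
- apply: continuous_pair => t; last by apply: cvgN; exact: sin_cont.
  by apply: cvgB; [exact: cvg_cst|exact: cos_cont].
- apply: continuous_pair; last exact: sin_cont.
  by move=> t; apply: cvgD; [exact: cvg_cst|exact: cos_cont].
Qed.

Definition strand_graph w j : set (R * R * R) :=
  [set (strand w j t, t) | t in `[0, 1]].

(** Compactness by induction on the word: the graph is the graph of one crossing
together with a squeezed copy of the graph for the rest of the word.  The two
pieces share the point at time 1/2. *)
Lemma strand_graph_compact w j : compact (strand_graph w j).
Proof.
have compact_path (f : R -> R * R) (u v : R) : continuous f ->
    compact [set (f t, t) | t in `[u, v]].
  move=> f_cont; apply: continuous_compact; last exact: segment_compact.
  by apply: continuous_subspaceT; apply: continuous_pair => // t; exact: cvg_id.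
elim: w j => [|l w IHw] j; first by apply: compact_path => t; exact: cvg_cst.
have -> : strand_graph (l :: w) j =
    [set (crossing l j (2 * t), t) | t in `[0, 2^-1]] `|`
    [set (q.1, (q.2 + 1) / 2) | q in strand_graph w (letter_perm l j)].
  apply/seteqP; split=> [_ [t /= t01 <-]|_ [[t /= t01 <-]|[_ [t /= t01 <-] <-]]].
  - move: t01; rewrite in_itv /= => /andP[t0 t1]; case: ifPn => [t2|/negbTE t2].
      by left; exists t => //=; rewrite in_itv /= t0 t2.
    right; exists (strand w (letter_perm l j) (2 * t - 1), 2 * t - 1) => /=.
      by exists (2 * t - 1) => //=; rewrite in_itv /=; apply/andP; split; lra.
    by congr (_, _); lra.
  - exists t; move: t01; rewrite /= !in_itv /= => /andP[t0 t1]; rewrite ?t1 //.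
    by rewrite t0 /=; lra.
  - move: t01; rewrite in_itv /= => /andP[t0 t1].
    exists ((t + 1) / 2) => /=; first by rewrite in_itv /=; apply/andP; split; lra.
    congr (_, _); case: ifP => t2; last by congr (strand _ _ _); lra.
    have -> : t = 0 by lra.
    by rewrite strand0 (_ : 2 * _ = 1) ?crossing1 //; lra.
apply: compactU.
  by apply: (compact_path (fun t => crossing l j (2 * t))) => t; apply: continuous_comp;
    [apply: cvgMr; exact: cvg_id|exact: crossing_continuous].
apply: continuous_compact (IHw _); apply: continuous_subspaceT.
apply: continuous_pair => q; first exact: cvg_fst.
by apply: cvgMl; apply: cvgD; [exact: cvg_snd|exact: cvg_cst].
Qed.

(** By the double angle formula sin (x / 2) vanishes, with x / 2 in [0, pi]. *)
Lemma cos_eq1_period (x : R) : 0 <= x <= 2 * pi -> cos x = 1 -> x = 0 \/ x = 2 * pi.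
Proof.
move=> /andP[x0 x2pi] cosx.
have cos_half : cos (x / 2) ^+ 2 *+ 2 - 1 = 1.
  by rewrite -cos_mulr2n (_ : x / 2 *+ 2 = x) // mulr2n; lra.
have sin_half : sin (x / 2) = 0.
  by apply/eqP; rewrite -sqrf_eq0; apply/eqP; have := cos2Dsin2 (x / 2); lra.
have [->|/eqP x_neq0] := eqVneq x 0; first by left.
have [->|/eqP x_neq2pi] := eqVneq x (2 * pi); first by right.
have : 0 < sin (x / 2) by apply: sin_gt0_pi; apply/andP; split; lra.
by rewrite sin_half ltxx.
Qed.

(** A point with first coordinate greater than -2 is wrapped at a positive
distance from the axis, so its distance and its angle can be recovered; only
the times 0 and 1 have the same angle. *)
Lemma wrap_inj (p q : R * R) t u :
    -2 < p.1 -> -2 < q.1 -> 0 <= t <= 1 -> 0 <= u <= 1 -> Defs.wrap p t = Defs.wrap q u ->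
  p = q /\ (t = u \/ [/\ t = 0 & u = 1] \/ [/\ t = 1 & u = 0]).
Proof.
wlog ut : p q t u / u <= t.
  move=> wlog_ut p2 q2 t01 u01 E; have [/wlog_ut|/ltW/wlog_ut tu] := leP u t.
    by apply.
  have [-> ut] := tu q p q2 p2 u01 t01 (esym E); split=> //.
  by case: ut => [->|[[]|[]]]; auto.
case: p q => [p1 p2] [q1 q2] /= p_gt q_gt /andP[t0 t1] /andP[u0 u1].
case=> cosE sinE /oppr_inj p2E.
have pqE : p1 = q1.
  have := congr2 (fun x y => x ^+ 2 + y ^+ 2) cosE sinE.
  rewrite !exprMn -!mulrDr !cos2Dsin2 !mulr1 => /eqP.
  by rewrite eqrXn2 //; first (by move/eqP; lra); lra.
have p_neq0 : 2 + p1 != 0 by rewrite gt_eqF //; lra.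
rewrite pqE p2E; split=> //; rewrite -pqE in cosE sinE.
move/(mulfI p_neq0): cosE => cosE; move/(mulfI p_neq0): sinE => sinE.
have cos1 : cos (2 * pi * (t - u)) = 1.
  by rewrite mulrBr cosB cosE sinE -!expr2 cos2Dsin2.
have pi0 := pi_gt0 R.
have range : 0 <= 2 * pi * (t - u) <= 2 * pi by apply/andP; split; nra.
have pi2 : 2 * pi != 0 :> R by apply: lt0r_neq0; rewrite mulr_gt0.
have [period|period] := cos_eq1_period range cos1.
- have tu : t - u = 0 by apply: (mulfI pi2); rewrite mulr0.
  by left; lra.
- have tu : t - u = 1 by apply: (mulfI pi2); rewrite mulr1.
  by right; right; split; lra.
Qed.

(** The two crossing points are c, s and -c, -s relative to their midpoint, on a
circle of radius 1/2. *)
Lemma half_turn (l : letter) t :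
  let c := cos (pi * t) / 2 in let s := (-1) ^+ l.2 * sin (pi * t) / 2 in
  c ^+ 2 + s ^+ 2 = 4^-1 /\ - 2^-1 <= c <= 2^-1 .
Proof.
move=> c s; split; last first.
  by have := cos_le1 (pi * t); have := cos_geN1 (pi * t); rewrite /c; lra.
rewrite /c /s !exprMn -mulrDl sqrr_sign mul1r cos2Dsin2 mul1r; lra.
Qed.

(** The two moving points are antipodal on a circle of radius 1/2 that keeps
away from the third slot. *)
Lemma crossing_inj l (i j : 'I_3) t : crossing l i t = crossing l j t -> i = j.
Proof.
rewrite /crossing; have [] := half_turn l t; move: (_ / 2) (_ / 2) => c s csE cP.
case: l => -[] e /= E; apply: val_inj; move: E;
  case: i j => -[|[|[|//]]] ? [] [|[|[|//]]] ? //=;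
  rewrite /slot /= => -[] *; exfalso; nra.
Qed.

Lemma crossing_gtN2 l j t : -2 < (crossing l j t).1.
Proof.
have [_ /andP[c1 c2]] := half_turn l t; move: c1 c2; rewrite /crossing.
move: (_ / 2) => c c1 c2; have k0 : 0 <= (l.1%:R : R) by exact: ler0n.
have j0 : 0 <= (j%:R : R) by exact: ler0n.
by do ![case: eqP => _ /=]; lra.
Qed.

Lemma strand_inj w (i j : 'I_3) t : strand w i t = strand w j t -> i = j.
Proof.
elim: w i j t => [|l w IHw] i j t /=.
  by case=> /addIr /eqP; rewrite eqr_nat => /eqP /val_inj.
case: ifP => _; first exact: crossing_inj.
by move/IHw/perm_inj.
Qed.

Lemma strand_gtN2 w j t : -2 < (strand w j t).1.
Proof.
elim: w j t => [|l w IHw] j t /=; last by case: ifP => _; first exact: crossing_gtN2.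
by have := ler0n R j; lra.
Qed.

Lemma word_perm_inj w : injective (word_perm w).
Proof. by elim: w => [|l w IHw] i j //= /IHw/perm_inj. Qed.

Definition closed_strands w (A : set 'I_3) : set (R * R * R) :=
  \bigcup_(j in A) [set Defs.wrap q.1 q.2 | q in strand_graph w j].

Lemma closed_strandsP w A q :
  closed_strands w A q <->
  exists j t, [/\ A j, 0 <= t <= 1 & q = Defs.wrap (strand w j t) t].
Proof.
split=> [[j Aj [_ [t /= t01 <-] <-]]|[j [t [Aj t01 ->]]]].
  by exists j, t; move: t01; rewrite in_itv.
by exists j => //; exists (strand w j t, t) => //=; exists t => //=; rewrite in_itv.
Qed.

(** A finite union of images of compact graphs under a continuous map. *)
Lemma closed_strands_closed w A : closed (closed_strands w A).
Proof.
apply: closed_bigcup => [|j _]; first exact: finite_finset.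
apply: compact_closed; first exact: norm_hausdorff.
apply: continuous_compact; last exact: strand_graph_compact.
apply: continuous_subspaceT.
have angle_cont (q : R * R * R) : {for q, continuous (fun q : R * R * R => 2 * pi * q.2)}.
  by apply: cvgMr; exact: cvg_snd.
have radius_cont (q : R * R * R) : {for q, continuous (fun q : R * R * R => 2 + q.1.1)}.
  apply: cvgD; first exact: cvg_cst.
  by apply: continuous_comp; exact: cvg_fst.
apply: continuous_pair; first apply: continuous_pair.
- move=> q; apply: cvgM; first exact: radius_cont.
  by apply: continuous_comp; [exact: angle_cont|exact: continuous_cos].
- move=> q; apply: cvgM; first exact: radius_cont.
  by apply: continuous_comp; [exact: angle_cont|exact: continuous_sin].
- move=> q; apply: cvgN; apply: continuous_comp; [exact: cvg_fst|exact: cvg_snd].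
Qed.

Lemma slot_inj : injective (@slot R).
Proof. by move=> i j [] /addIr /eqP; rewrite eqr_nat => /eqP /val_inj. Qed.

(** The strand starting in j closes up on itself, and is disjoint from the other
strands: at equal times strands have distinct positions, and at the times 0
and 1, which are glued, they are matched by the permutation.  Both parts are
closed, so the closure would be disconnected, while a circle is connected. *)
Lemma knot_no_fixed_slot w j : is_knot (@closure_of_word R w) -> word_perm w j <> j.
Proof.
case=> f [f_cont _ _ KE] wj.
have K_conn : connected (@closure_of_word R w).
  rewrite KE; apply: connected_continuous_connected.
    by apply/connected_intervalP.
  exact: continuous_subspaceT.
set C := closed_strands w [set j]; set D := closed_strands w [set~ j].
have CD q : C q -> D q -> False.
  move=> /closed_strandsP[_ [t [-> t01 ->]]] /closed_strandsP[i [u [/= ij u01]]].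
  move/wrap_inj => /(_ (strand_gtN2 _ _ _) (strand_gtN2 _ _ _) t01 u01)[E tu].
  apply: ij; case: tu E => [<-|[[-> ->]|[-> ->]]]; first by move/strand_inj.
    by rewrite strand0 strand1 -{1}wj => /slot_inj/word_perm_inj.
  by rewrite strand0 strand1 wj => /slot_inj.
have KCD q : @closure_of_word R w q <-> C q \/ D q.
  split=> [[i [t [t01 qE]]]|]; last by case=> /closed_strandsP[i [t [_ t01 qE]]]; exists i, t.
  by have [ij|/eqP ij] := eqVneq i j; [left|right]; apply/closed_strandsP; exists i, t.
have C0 : C !=set0.
  exists (Defs.wrap (slot R j) 0); apply/closed_strandsP; exists j, 0.
  by rewrite strand0 lexx ler01.
have CE : C = @closure_of_word R w.
  apply: K_conn => //.
    exists (~` D); first exact/closed_openC/closed_strands_closed.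
    apply/seteqP; split=> q.
      by move=> Cq; split; [apply/KCD; left|move/(CD _ Cq)].
    by case=> /KCD[|Dq /(_ Dq)].
  exists C; first exact: closed_strands_closed.
  apply/seteqP; split=> q; last by case.
  by move=> Cq; split=> //; apply/KCD; left.
have [i ij] : exists i : 'I_3, i != j.
  exists (if j == ord0 then ord_max else ord0).
  by case: (eqVneq j ord0) => [->|] //; rewrite eq_sym.
have Dq : D (Defs.wrap (slot R i) 0).
  by apply/closed_strandsP; exists i, 0; rewrite strand0 lexx ler01; split=> //; exact/eqP.
by apply: (CD _ _ Dq); rewrite CE; apply/KCD; right.
Qed.

End ClosedBraids.

Lemma knot_knot_condition (R : realType) (x : B3) F :
    closure_is_knot R x -> admissible F -> are_conjugate x (braid_of_form F) ->
  knot_condition F.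
Proof.
have pa := letter_perm_action.
case=> w [-> w_knot] admF [g FE]; apply/negPn/negP => /(form_fixed_slot admF)[j].
rewrite FE conjgE !(braid_actM pa) //; set i := perm_act g^-1 j => gj.
apply: (knot_no_fixed_slot (j := i) w_knot).
by rewrite -[LHS](braid_act_word pa) // -[LHS](braid_actK pa g) // gj.
Qed.

Theorem proposition3p2 (R : realType) (gamma : B3) :
  [/\ exists F : normal_form,
        admissible F /\ are_conjugate gamma (braid_of_form F),
      positive_braid gamma ->
        forall F : normal_form,
          admissible F -> are_conjugate gamma (braid_of_form F) ->
          (0 <= ell F)%R
    & closure_is_knot R gamma ->
        forall F : normal_form,
          admissible F -> are_conjugate gamma (braid_of_form F) ->
          knot_condition F].
Proof.
split=> [|gamma_pos F|gamma_knot F].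
- have [m [w ->]] := Delta_pos_word_form gamma; exact: has_form_pos_word.
- exact: ell_ge0_of_positive gamma_pos.
- exact: knot_knot_condition gamma_knot.
Qed.
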